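(* Let $(X,r)$ be an indecomposable solution of size $|X|=ab$ and $T$-partition $(a,c,c')$, where the positive integers $a,b,c,c'$ are pairwise coprime, except for, possibly, $c$ and $c'$ (i.e. $c$ and $c'$ need not be coprime to each other). Then one cannot have $b>a+c$.
   Context: A solution $(X,r)$ is a non-empty finite set $X$, with $|X|>1$, together with an involutive map $r\colon X\times X\to X\times X$, $r(x,y)=(\sigma_x(y),\tau_y(x))$, satisfying $r_1r_2r_1=r_2r_1r_2$ on $X^3$, where $r_1=r\times \mathrm{Id}_X$ and $r_2=\mathrm{Id}_X\times r$, and such that all maps $\sigma_x$ and $\tau_x$ ($x\in X$) are bijections of $X$. A solution is decomposable if $X=Y\sqcup Z$ with $Y,Z$ non-empty and disjoint, $r(Y\times Y)=Y\times Y$ and $r(Z\times Z)=Z\times Z$; equivalently, if the permutation group $\mathcal{G}(X,r)$ generated by all $\sigma_x$, $x\in X$, does not act transitively on $X$. Otherwise it is indecomposable. The diagonal map of $(X,r)$ is the permutation $T\colon X\to X$, $T(x)=\tau_x^{-1}(x)$. The $T$-partition of $(X,r)$ is the partition of the integer $|X|$ given by the multiset of sizes of the $T$-orbits in $X$ (fixed points counted as orbits of size $1$; the order of the terms is irrelevant). *)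

(* Defs.v *)
From mathcomp Require Import all_boot all_fingroup.

Set Implicit Arguments.
Unset Strict Implicit.
Unset Printing Implicit Defensive.

Section Maps.
Variables (X : finType) (r : X * X -> X * X).

(* r (x, y) = (sigma x y, tau y x): the index of tau is the second entry. *)
Definition sigma (x y : X) : X := (r (x, y)).1.
Definition tau (y x : X) : X := (r (x, y)).2.

Definition r1 (t : X * X * X) : X * X * X := (r t.1, t.2).
Definition r2 (t : X * X * X) : X * X * X :=
  let: (x, y, z) := t in let: (u, v) := r (y, z) in (x, u, v).

End Maps.

Record solution (X : finType) : Type := Solution {
  sol_map :> X * X -> X * X;
  sol_card : 1 < #|X|;
  sol_invol : involutive sol_map;
  sol_braid : r1 sol_map \o r2 sol_map \o r1 sol_map
                =1 r2 sol_map \o r1 sol_map \o r2 sol_map;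
  sol_sigma_bij : forall x, bijective (sigma sol_map x);
  sol_tau_bij : forall x, bijective (tau sol_map x)
}.

Definition decomposable (X : finType) (r : solution X) : Prop :=
  exists Y Z : {set X},
    [/\ Y != set0, Z != set0, [disjoint Y & Z] & Y :|: Z = [set: X]] /\
    [set r p | p in setX Y Y] = setX Y Y /\
    [set r p | p in setX Z Z] = setX Z Z.

Definition indecomposable (X : finType) (r : solution X) : Prop :=
  ~ decomposable r.

(* finv is the two-sided inverse since tau r x is injective. *)
Definition diag (X : finType) (r : solution X) (x : X) : X := finv (tau r x) x.

Lemma diag_inj (X : finType) (r : solution X) : injective (diag r).
Proof.
have sigma_diag x : sigma r (diag r x) x = diag r x.
  have tau_inj := bij_inj (sol_tau_bij r x).
  have tau_diag : tau r x (diag r x) = x by rewrite /diag f_finv.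
  apply: tau_inj; rewrite tau_diag.
  have := sol_invol r (diag r x, x).
  rewrite [r (diag r x, x)]surjective_pairing.
  rewrite -/(sigma r _ _) -/(tau r _ _) tau_diag /tau => -> //.
move=> x y eq_xy; apply: (bij_inj (sol_sigma_bij r (diag r x))).
by rewrite sigma_diag eq_xy sigma_diag.
Qed.

Definition diag_perm (X : finType) (r : solution X) : {perm X} :=
  perm (@diag_inj X r).

(* A partition of an integer is a list of its terms, to be compared up to
   order with perm_eq; fixed points of T give terms equal to 1. *)
Definition T_partition (X : finType) (r : solution X) : seq nat :=
  [seq #|A| | A : {set X} <- enum (porbits (diag_perm r))].

(* Main.v *)
From HB Require Import structures.
Require Import Defs.
From mathcomp Require Import all_boot all_fingroup.
From mathcomp Require Import ssralg zmodp all_solvable integral_char.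
Set Implicit Arguments.
Unset Strict Implicit.
Unset Printing Implicit Defensive.
Import GRing.Theory.

(** Let lambda be the action on X of the structure group of the solution.  This
group also carries an addition, generated by X, with
a o b = a + lambda_a(b), where o is the group law.  Reducing the coordinates
modulo a suitable period N gives a finite group: its elements are the weights
X -> Z/N, its law is the circle product, and it acts on X, transitively when
the solution is indecomposable ([indecomposable_transitive]).

Two facts drive the proof.  First, additive Hall subgroups are Hall subgroups
for the circle product ([torsion_Hall]), so they exist for all sets of primes
and the group is solvable by P. Hall's criterion ([brace_solvable]).  Secondly,
the additive multiple k x of a point x acts on x as the k-th power of the
diagonal map T, up to inversion ([brace_act_unit]), and the Hall subgroups are
generated by such multiples ([torsion_gen]).  Passing from x to k x is the
cabling of solutions.

These imply that an indecomposable solution never has T of order prime to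
#|X| ([indecomposable_diag_order]): in a solvable group, the conjugates of a
point stabilizer meet some Sylow subgroup P inside one proper subgroup of P,
for a prime p dividing #|X|; but the generators k x of P each fix the point x,
since T^k = 1.

Now let T have cycles of lengths a, c, c' with #|X| = a * b, and suppose that
b > a + c, that is c' > (a - 1) * b.  Consider the Hall subgroup H for the
primes that do not divide a.  Its orbits have size divisible by b, as b is
prime to a.  Its generators k x act on the cycle of length c' through T^k with
k prime to c', so this cycle lies in one orbit.  That orbit has more than
(a - 1) * b points, so it is X and a divides the order of H: this forces a = 1.
Then T has order dividing c * c', which is prime to b = #|X|, and the previous
result gives a contradiction. *)

(** * Solvability from Hall subgroups, and Sylow subgroups of solvable groups *)

Section SolvableGroups.
Import GroupScope.

Lemma coprime_prime_powers (p q m n : nat) :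
  p != q -> p.-nat m -> q.-nat n -> coprime m n.
Proof.
move=> neq_pq pm qn; apply: (pnat_coprime pm); apply: sub_in_pnat qn => u _.
by move=> /[!inE]/eqP->; rewrite eq_sym.
Qed.

(** Coprime indices give G = H1 H2, and H1 fixes P under conjugation, so every
G-conjugate of P is an H2-conjugate.  One of them lies in a Sylow subgroup of
H2, which is Sylow in G; hence all of them lie in H2. *)
Lemma pgroup_sub_gcore gT (p : nat) (G H1 H2 P : {group gT}) :
    H1 \subset G -> H2 \subset G -> coprime #|G : H1| #|G : H2| ->
    p^'.-nat #|G : H2| -> p.-group P -> P <| H1 ->
  P \subset gcore H2 G.
Proof.
move=> sH1 sH2 co12 p'H2 pP /andP[sPH1 nPH1].
have defG := coprime_index_mulG sH1 sH2 co12.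
have sPG := subset_trans sPH1 sH1.
have [S sylS] := Sylow_exists p H2.
have sylSG : p.-Sylow(G) S.
  have [sSH2 pS p'S] := and3P sylS.
  rewrite /pHall (subset_trans sSH2) // pS.
  by rewrite -(Lagrange_index sH2 sSH2) pnatM p'H2.
have conjP h1 h2 : h1 \in H1 -> P :^ (h1 * h2) = P :^ h2.
  by move=> h1H; rewrite conjsgM (normsP nPH1).
have [x xG sPxS] := Sylow_Jsub sylSG sPG pP.
have sPH2 : P \subset H2.
  have sPxH2 := subset_trans sPxS (pHall_sub sylS).
  move: xG sPxH2; rewrite -{1}defG => /mulsgP[h1 h2 h1H h2H ->].
  by rewrite conjP // -{1}(conjGid h2H) conjSg.
apply/bigcapsP=> x1 x1G; rewrite -sub_conjgV.
move: (groupVr x1G); rewrite -{1}defG => /mulsgP[h1 h2 h1H h2H ->].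
by rewrite conjP // -{1}(conjGid h2H) conjSg.
Qed.

(** Wielandt's criterion.  A minimal normal subgroup P of H1 is a p-group, and p
divides at most one of the indices of H2 and H3.  The normal closure of P in G
then lies in the other one, so it is solvable, and induction applies to the
quotient. *)
Lemma solvable_of_3_coprime_indices gT (G H1 H2 H3 : {group gT}) :
    H1 \subset G -> H2 \subset G -> H3 \subset G ->
    solvable H1 -> solvable H2 -> solvable H3 ->
    coprime #|G : H1| #|G : H2| -> coprime #|G : H1| #|G : H3| ->
    coprime #|G : H2| #|G : H3| ->
  solvable G.
Proof.
have [n leGn] := ubnP #|G|.
elim: n => // n IHn in gT G H1 H2 H3 leGn *.
move=> sH1 sH2 sH3 sol1 sol2 sol3 co12 co13 co23.
have [H1_1|ntH1] := eqVneq (H1 : {set gT}) 1.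
  move: co12; rewrite H1_1 indexg1 => co12.
  have /eqP : #|G : H2| == 1%N.
    by rewrite -dvdn1 -(eqP co12) dvdn_gcd dvdn_indexg dvdnn.
  by move/(index1g sH2) => <-.
have [P [sPH1 nsPH1 ntP /is_abelemP[p pr_p abelP]]] :=
  solvable_norm_abelem sol1 (normal_refl H1) ntH1.
have pP := abelem_pgroup abelP.
suff [N [nsNG ntN solN]] :
  exists N : {group gT}, [/\ N <| G, N :!=: 1 & solvable N].
  rewrite (series_sol nsNG) solN /=.
  have nNG := normal_norm nsNG.
  have dvd (H : {group gT}) : H \subset G -> #|G / N : H / N| %| #|G : H|.
    by move=> sHG; rewrite index_quotient // subIset // nNG.
  apply: (IHn _ _ (H1 / N) (H2 / N) (H3 / N))%G;
    rewrite ?quotientS ?quotient_sol //.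
  - exact: leq_trans (ltn_quotient ntN (normal_sub nsNG)) _.
  - exact: coprime_dvdl (dvd _ sH1) (coprime_dvdr (dvd _ sH2) co12).
  - exact: coprime_dvdl (dvd _ sH1) (coprime_dvdr (dvd _ sH3) co13).
  - exact: coprime_dvdl (dvd _ sH2) (coprime_dvdr (dvd _ sH3) co23).
have core (H : {group gT}) :
    H \subset G -> solvable H -> coprime #|G : H1| #|G : H| ->
    p^'.-nat #|G : H| ->
    exists N : {group gT}, [/\ N <| G, N :!=: 1 & solvable N].
  move=> sHG solH co1H p'H; exists [group of gcore H G]; split.
  - exact: gcore_normal.
  - have sPN := pgroup_sub_gcore sH1 sHG co1H p'H pP nsPH1.
    by apply: contraNneq ntP => N1; rewrite -subG1 -N1.
  - exact: solvableS (gcore_sub H G) solH.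
have [p_dv2|p_ndv2] := boolP (p %| #|G : H2|).
  apply: (core H3) => //; rewrite p'natE //.
  by rewrite -prime_coprime // (coprime_dvdl p_dv2).
by apply: (core H2) => //; rewrite p'natE.
Qed.

(** P. Hall's criterion.  A p-complement inherits the hypothesis by intersecting
it with the q-complements of G, so three p-complements for different primes
feed Wielandt's criterion; Burnside's theorem covers the orders with at most
two prime divisors. *)
Lemma Hall_solvable gT (G : {group gT}) :
    (forall p, prime p -> exists K : {group gT}, p^'.-Hall(G) K) -> solvable G.
Proof.
have [n leGn] := ubnP #|G|.
elim: n => // n IHn in G leGn * => compl.
have [le2|] := leqP (size (primes #|G|)) 2; first exact: Burnside_p_a_q_b.
case def_pi: (primes #|G|) => [|p [|q [|r ps]]] // _.
have uniq_pi := primes_uniq #|G|.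
have pi_prop s : s \in primes #|G| -> prime s /\ s %| #|G|.
  by rewrite mem_primes => /and3P[].
have sol_compl s : s \in primes #|G| ->
    exists K : {group gT}, [/\ K \subset G, solvable K & s.-nat #|G : K|].
  move=> /pi_prop[pr_s s_dv]; have [K hallK] := compl _ pr_s.
  have [sKG s'K sGK] := and3P hallK; rewrite pnatNK in sGK.
  exists K; split=> //; apply: IHn => [|t pr_t].
    apply: leq_trans (proper_card _) leGn.
    rewrite properEneq sKG andbT; apply: contraTneq s_dv => defG.
    by rewrite -defG -p'natE.
  have [-> | neq_ts] := eqVneq t s.
    by exists K; rewrite /pHall subxx s'K indexgg.
  have [L hallL] := compl _ pr_t.
  have [sLG t'L tGL] := and3P hallL; rewrite pnatNK in tGL.
  have defG : L * K = G.
    apply: coprime_index_mulG => //; exact: coprime_prime_powers neq_ts tGL sGK.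
  exists (K :&: L)%G; rewrite /pHall subsetIl (pgroupS (subsetIr K L)) //=.
  by rewrite indexgI pnatNK -indexMg defG.
have /sol_compl[H1 [sH1 sol1 pH1]] : p \in primes #|G|.
  by rewrite def_pi !inE eqxx.
have /sol_compl[H2 [sH2 sol2 qH2]] : q \in primes #|G|.
  by rewrite def_pi !inE eqxx orbT.
have /sol_compl[H3 [sH3 sol3 rH3]] : r \in primes #|G|.
  by rewrite def_pi !inE eqxx !orbT.
move: uniq_pi; rewrite def_pi /= !inE !negb_or.
move=> /and3P[/and3P[pq pr _] /andP[qr _] _].
apply: (solvable_of_3_coprime_indices sH1 sH2 sH3) => //.
- exact: coprime_prime_powers pq pH1 qH2.
- exact: coprime_prime_powers pr pH1 rH3.
- exact: coprime_prime_powers qr qH2 rH3.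
Qed.

(** Modulo the core L of M, a minimal normal subgroup K / L is a p-group that is
not inside M / L, so G = M K and the index of M divides the order of K / L. *)
Lemma maximal_solvable_index gT (G M : {group gT}) :
  solvable G -> maximal M G -> exists2 p, prime p & p.-nat #|G : M|.
Proof.
move=> solG maxM; have /andP[sMG not_sGM] := maxgroupp maxM.
pose L := gcore M G.
have nsLG : L <| G := gcore_normal sMG.
have sLM : L \subset M := gcore_sub M G.
have ntGL : (G / L)%G :!=: 1.
  apply: contra not_sGM => /eqP/trivgP; rewrite quotient_sub1 ?normal_norm //.
  by move/subset_trans; apply.
have [Kb [_ nsKb ntKb /is_abelemP[p pr_p /abelem_pgroup pKb]]] :=
  solvable_norm_abelem (quotient_sol _ solG) (normal_refl _) ntGL.
have [K defKb sLK nsKG] := inv_quotientN nsLG nsKb.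
have [sKG nKG] := andP nsKG.
have not_sKM : ~~ (K \subset M).
  apply: contra ntKb => sKM; rewrite defKb -subG1 quotient_sub1.
    exact: gcore_max.
  exact: subset_trans sKG (normal_norm nsLG).
have defG : M * K = G.
  rewrite -norm_joinEl ?(subset_trans sMG) //.
  have [_ /(_ (M <*> K)%G)] := maxgroupP maxM.
  rewrite /= properE join_subG sKG sMG joing_subl /=.
  have [sGKM _|_ /(_ isT isT) defM] := boolP (G \subset M <*> K).
    by apply/eqP; rewrite eqEsubset sGKM join_subG sKG sMG.
  by rewrite -defM joing_subr in not_sKM.
exists p => //; rewrite -defG indexMg -indexgI.
have sLKM : L \subset K :&: M by rewrite subsetI sLK sLM.
apply: pnat_dvd (indexgS K sLKM) _.
move: pKb; rewrite defKb /pgroup card_quotient //.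
exact: subset_trans sKG (normal_norm nsLG).
Qed.

(** Take M maximal above S, of index a power of p.  Then G = M P, so P is not
inside M, and a maximal subgroup Q of P above P :&: M is normal in P.  As
conjugates of M by elements of M P are conjugates by elements of P, they all
meet P inside Q. *)
Lemma solvable_conj_in_proper_Sylow gT (G S : {group gT}) :
    solvable G -> S \proper G ->
  exists2 p, p \in \pi(#|G : S|) & forall P : {group gT}, p.-Sylow(G) P ->
    exists2 Q : {group gT}, Q \proper P &
      forall x, x \in G -> P :&: S :^ x \subset Q.
Proof.
move=> solG /andP[sSG not_sGS].
have [defG | [M maxM sSM]] := maximal_exists sSG.
  by rewrite defG subxx in not_sGS.
have /andP[sMG not_sGM] := maxgroupp maxM.
have [p pr_p pGM] := maximal_solvable_index solG maxM.
exists p => [|P sylP].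
  rewrite mem_primes pr_p indexg_gt0 (dvdn_trans _ (indexgS _ sSM)) //.
  rewrite -[p %| _]negbK -p'natE //; apply: contra not_sGM => p'GM.
  rewrite -indexg_eq1 -(part_pnat_id pGM); exact/eqP/part_p'nat.
have [sPG pP p'GP] := and3P sylP.
have defG : M * P = G.
  by apply: coprime_index_mulG => //; apply: pnat_coprime pGM p'GP.
have not_sPM : ~~ (P \subset M).
  by apply: contra not_sGM => sPM; rewrite -defG mulGSid.
have [defP | [Q maxQ sQ]] := maximal_exists (subsetIl P M).
  by rewrite -defP subsetIr in not_sPM.
exists Q => [|x]; first exact: maxgroupp maxQ.
rewrite -{1}defG => /mulsgP[m y mM yP ->].
have [_ nQP] := andP (p_maximal_normal pP maxQ).
rewrite -(normsP nQP y yP) -{1}(conjGid yP) conjsgM -conjIg conjSg.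
apply: subset_trans sQ; rewrite setIS // -(conjGid mM).
by rewrite conjSg.
Qed.

End SolvableGroups.

(** * Powers of a permutation and its cycles *)

Section PermPowers.
Variable X : finType.
Implicit Types s : {perm X}.

Lemma expgn_porbit s m x : #|porbit s x| %| m -> (s ^+ m)%g x = x.
Proof.
move=> /dvdnP[q ->]; rewrite mulnC expgM permX.
by elim: q => //= q ->; rewrite permX iter_porbit.
Qed.

(** Some multiple of k is 1 modulo the length of the cycle of x, so a power of
s ^+ k acts on that cycle as s. *)
Lemma porbit_sub_coprime_closed s k x (O : {set X}) :
    coprime k #|porbit s x| -> x \in O ->
    (forall y, y \in O -> (s ^+ k)%g y \in O) ->
  porbit s x \subset O.
Proof.
move=> co_k Ox Ok; apply/subsetP=> _ /porbitP[i ->].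
elim: i => [|i IH]; first by rewrite perm1.
have Okj j y : y \in O -> (s ^+ (k * j))%g y \in O.
  move=> Oy; elim: j => [|j IHj]; first by rewrite muln0 perm1.
  by rewrite mulnS addnC expgD permM Ok.
rewrite expgSr permM; set y := (s ^+ i)%g x in IH *.
have def_c : #|porbit s y| = #|porbit s x| by rewrite porbit_perm.
set c := #|porbit s x| in co_k def_c; set u := chinese k c 0 1.
have /dvdnP[j def_u] : k %| u by rewrite /dvdn chinese_modl // mod0n.
have [def_1 | c_neq1] := eqVneq c 1%N.
  by rewrite -[s]expg1 expgn_porbit // def_c def_1.
have u_mod1 : u %% c = 1.
  rewrite chinese_modr // modn_small //.
  by rewrite ltn_neqAle eq_sym c_neq1 lt0n card_porbit_neq0.
have := Okj j y IH; rewrite mulnC -def_u (divn_eq u c) u_mod1 expgD expg1 permM.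
by rewrite expgn_porbit // def_c dvdn_mull.
Qed.

End PermPowers.

(** * The additive coordinates of the structure group *)

Lemma perm_eq_count_mem (T : eqType) (s t : seq T) :
  (forall x, count_mem x s = count_mem x t) -> perm_eq s t.
Proof. by move=> eq_st; apply/allP=> x _ /=; apply/eqP. Qed.

Section CycleSet.
Variables (X : finType) (r : solution X).

(** The inverse of sigma x: as products of permutations compose from left to
right, these inverses extend to a right action of the structure group. *)
Definition lperm (x : X) : {perm X} :=
  (perm (bij_inj (sol_sigma_bij r x)))^-1%g.

Lemma lpermK x y : sigma r x (lperm x y) = y.
Proof. by rewrite -[LHS](permE (bij_inj (sol_sigma_bij r x))) permKV. Qed.

Lemma lperm_sigma x y : lperm x (sigma r x y) = y.
Proof. by apply: (bij_inj (sol_sigma_bij r x)); rewrite lpermK. Qed.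

Lemma sigma_tau x y : sigma r (sigma r x y) (tau r y x) = x.
Proof. by rewrite {1}/sigma /sigma /tau -surjective_pairing sol_invol. Qed.

Lemma tau_sigma x y : tau r (tau r y x) (sigma r x y) = y.
Proof. by rewrite {1}/tau /sigma /tau -surjective_pairing sol_invol. Qed.

Lemma tau_lperm x y : tau r y x = lperm (sigma r x y) x.
Proof. by rewrite -{3}(sigma_tau x y) lperm_sigma. Qed.

Lemma sigma_braid x y z :
  sigma r x (sigma r y z) = sigma r (sigma r x y) (sigma r (tau r y x) z).
Proof.
have := congr1 (fun t => t.1.1) (sol_braid r (x, y, z)).
rewrite /= /r1 /r2 /sigma /tau /=.
case: (r (x, y)) => u v /=; case: (r (v, z)) => v' z' /=.
case: (r (y, z)) => y' z'' /=; case: (r (x, y')) => x' y'' /=.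
case: (r (y'', z'')) => a b /=.
by case: (r (u, v')) => p q /= ->.
Qed.

(** Rump's cycle set identity, the form that the braid relation takes for the
inverses of the sigma x. *)
Lemma lperm_cycle x y :
  (lperm x * lperm (lperm x y) = lperm y * lperm (lperm y x))%g.
Proof.
apply/permP=> z; rewrite !permM.
have tau_xy : tau r (lperm x y) x = lperm y x by rewrite tau_lperm lpermK.
rewrite -[z in RHS](lpermK x) -[lperm x z in RHS](lpermK (lperm x y)).
by rewrite sigma_braid lpermK tau_xy !lperm_sigma.
Qed.

Lemma lperm_diag x : lperm x x = (diag_perm r)^-1%g x.
Proof.
have sigma_diag y : sigma r (diag r y) y = diag r y.
  have tau_inj := bij_inj (sol_tau_bij r y).
  have tau_diag : tau r y (diag r y) = y by rewrite /diag f_finv.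
  apply: tau_inj; rewrite tau_diag.
  by have := tau_sigma (diag r y) y; rewrite tau_diag.
set y := (diag_perm r)^-1%g x.
have diag_y : diag r y = x by rewrite -[RHS](permKV (diag_perm r)) [RHS]permE.
have := sigma_diag y; rewrite diag_y => sigma_xy.
by rewrite -{2}sigma_xy lperm_sigma.
Qed.

Local Notation D := ((diag_perm r)^-1)%g.

(** A word stands for the sum of its letters in the additive group of the brace;
[word_perm] is the inverse of the permutation by which this sum acts.  Adding
the letter y on top of s contributes the letter y seen through the action of
s, because a + y = a o (lambda_a^-1 y) in a brace. *)
Fixpoint word_perm (s : seq X) : {perm X} :=
  if s is y :: s' then (word_perm s' * lperm (word_perm s' y))%g else 1%g.

Lemma word_perm_cat t s :
  word_perm (t ++ s) = (word_perm s * word_perm (map (word_perm s) t))%g.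
Proof. by elim: t => [|y t IH] /=; rewrite ?mulg1 // IH permM mulgA. Qed.

(** The cycle set identity is the commutation of two adjacent letters, so
[word_perm] depends only on the sum that the word represents. *)
Lemma word_perm_perm s t : perm_eq s t -> word_perm s = word_perm t.
Proof.
have swap y z u : word_perm (y :: z :: u) = word_perm (z :: y :: u).
  by rewrite /= !permM -!mulgA lperm_cycle.
have move_front y u1 u2 : word_perm (u1 ++ y :: u2) = word_perm (y :: u1 ++ u2).
  by elim: u1 => // x u1 IH; rewrite -[RHS](swap x y (u1 ++ u2)) /= IH.
elim: s t => [|y s IH] t; first by rewrite perm_sym => /perm_nilP->.
move=> eq_st.
have /splitPr def_t : y \in t by rewrite -(perm_mem eq_st) mem_head.
case: def_t eq_st => t1 t2.
rewrite -[y :: t2]cat1s perm_sym perm_catCA /= perm_cons perm_sym.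
by rewrite move_front /= => /IH->.
Qed.

(** Cabling: the k-th additive multiple of x moves x itself along its cycle
under the diagonal map. *)
Lemma word_perm_nseq k x : word_perm (nseq k x) x = (D ^+ k)%g x.
Proof.
by elim: k => [|k IH]; rewrite ?perm1 //= permM IH lperm_diag expgSr permM.
Qed.

Lemma word_perm_nseqD i j x :
  word_perm (nseq (i + j) x)
  = (word_perm (nseq j x) * word_perm (nseq i ((D ^+ j)%g x)))%g.
Proof. by rewrite nseqD word_perm_cat map_nseq word_perm_nseq. Qed.

(** The period is any N for which N equal letters act trivially; the predecessor
is named because a positive modulus has the form n.+1. *)
Definition period_pred := (#[D]%g * #|{perm X}|).-1.
Local Notation N := period_pred.+1.

Lemma periodE : N = (#[D]%g * #|{perm X}|)%N.
Proof.
by rewrite prednK // muln_gt0 order_gt0; apply/card_gt0P; exists 1%g.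
Qed.

(** Along m = #[D] equal letters x the letter comes back to itself, so m * j
equal letters act as the j-th power of a fixed permutation. *)
Lemma word_perm_period x : word_perm (nseq N x) = 1%g.
Proof.
rewrite periodE; set m := #[D]%g.
have pow j : word_perm (nseq (m * j) x) = (word_perm (nseq m x) ^+ j)%g.
  elim: j => [|j IH]; first by rewrite muln0.
  by rewrite mulnS addnC word_perm_nseqD expg_order perm1 expgS IH.
by rewrite pow -cardsT expg_cardG ?inE.
Qed.

Definition weight := {ffun X -> 'I_N}.

Definition word_weight (s : seq X) : weight := [ffun x => inZp (count_mem x s)].
Definition weight_word (v : weight) : seq X :=
  flatten [seq nseq (v x) x | x <- enum X].
Definition weight_perm (v : weight) := word_perm (weight_word v).

Lemma count_weight_word v x : count_mem x (weight_word v) = v x.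
Proof.
rewrite count_flatten -map_comp sumnE big_map big_enum /= (bigD1 x) //=.
rewrite count_nseq /= eqxx mul1n big1 ?addn0 // => y /negPf neq_yx.
by rewrite count_nseq /= neq_yx.
Qed.

Lemma weight_wordK : cancel weight_word word_weight.
Proof.
by move=> v; apply/ffunP=> x; rewrite ffunE count_weight_word valZpK.
Qed.

Lemma word_weight_cat s t :
  word_weight (s ++ t) = (word_weight s + word_weight t)%R.
Proof.
by apply/ffunP=> x; rewrite !ffunE; apply: val_inj; rewrite /= count_cat modnDm.
Qed.

Lemma word_weight_perm (g : {perm X}) t :
  word_weight (map g t) = [ffun x => word_weight t (g^-1%g x)].
Proof.
apply/ffunP=> x; rewrite !ffunE count_map; congr inZp; apply: eq_count => y /=.
by rewrite (canF_eq (permK g)).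
Qed.

(** The action of a word factors through the finite group of weights: when the
multiplicity of a letter reaches the period N, its N copies can be moved to
the end, where they act trivially. *)
Lemma word_permE s : word_perm s = weight_perm (word_weight s).
Proof.
elim: s => [|y s IH].
  apply: word_perm_perm; apply: perm_eq_count_mem => x.
  by rewrite /= count_weight_word ffunE.
rewrite /= IH -[LHS]/(word_perm (y :: weight_word (word_weight s))).
set v := word_weight s; set v' := word_weight (y :: s).
(* v' adds 1 to v at y modulo N: the two words differ, up to order, by N copies
   of y exactly when this addition carries over. *)
have v'E x : v' x = ((y == x) + v x) %% N :> nat by rewrite !ffunE /= modnDmr.
have [lt_vy | ge_vy] := ltnP (v y).+1 N.
  apply: word_perm_perm; apply: perm_eq_count_mem => x.
  rewrite /= !count_weight_word v'E.
  by case: (y =P x) => [<-|_]; rewrite modn_small ?add1n ?add0n ?ltn_ord.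
have vyN : (v y).+1 = N by apply/eqP; rewrite eqn_leq ge_vy ltn_ord.
rewrite (@word_perm_perm _ (weight_word v' ++ nseq N y)).
  by rewrite word_perm_cat word_perm_period mul1g (eq_map (@perm1 _)) map_id.
apply: perm_eq_count_mem => x.
rewrite count_cat !count_weight_word v'E count_nseq.
rewrite -[count _ _]/((y == x) + count_mem x (weight_word v)) count_weight_word.
rewrite -[pred1 x y]/(y == x).
case: (y =P x) => [<-|_]; rewrite ?add1n ?vyN ?modnn ?mul1n //.
by rewrite mul0n addn0 modn_small ?ltn_ord.
Qed.

Definition relabel (g : {perm X}) (w : weight) : weight := [ffun x => w (g x)].

Lemma relabelD g : {morph relabel g : v w / (v + w)%R}.
Proof. by move=> v w; apply/ffunP=> x; rewrite !ffunE. Qed.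

Lemma relabelM g h w : relabel (g * h)%g w = relabel g (relabel h w).
Proof. by apply/ffunP=> x; rewrite !ffunE permM. Qed.

Lemma relabel1 w : relabel 1%g w = w.
Proof. by apply/ffunP=> x; rewrite ffunE perm1. Qed.

Lemma relabel_word (g : {perm X}) t :
  relabel g (word_weight t) = word_weight (map g^-1%g t).
Proof. by rewrite word_weight_perm invgK. Qed.

(** The circle product v o w = v + lambda_v(w) of the brace. *)
Definition circ (v w : weight) : weight := (v + relabel (weight_perm v) w)%R.

Lemma weight_perm_circ v w :
  weight_perm (circ v w) = (weight_perm v * weight_perm w)%g.
Proof.
rewrite /circ -{1}(weight_wordK v) -{1}(weight_wordK w) relabel_word addrC.
rewrite -word_weight_cat -word_permE word_perm_cat -map_comp; congr (_ * _)%g.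
by rewrite (eq_map (permKV _)) map_id.
Qed.

Lemma weight_perm0 : weight_perm 0%R = 1%g.
Proof.
rewrite (_ : 0%R = word_weight [::]) -?word_permE //.
by apply/ffunP=> x; rewrite !ffunE; apply: val_inj.
Qed.

Definition circ_inv (v : weight) : weight :=
  (- relabel (weight_perm v)^-1%g v)%R.

Lemma circA : associative circ.
Proof.
by move=> u v w; rewrite [RHS]/circ weight_perm_circ relabelM -addrA -relabelD.
Qed.

Lemma circ0 : left_id 0%R circ.
Proof. by move=> v; rewrite /circ weight_perm0 relabel1 add0r. Qed.

Lemma circ_invl : left_inverse 0%R circ_inv circ.
Proof.
move=> v; pose w := circ_inv v.
have vw0 : circ v w = 0%R.
  rewrite /circ /w /circ_inv.
  apply/eqP; rewrite addr_eq0; apply/eqP/ffunP=> x.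
  by rewrite !ffunE opprK permK.
have wE : weight_perm w = (weight_perm v)^-1%g.
  apply: (mulgI (weight_perm v)).
  by rewrite -weight_perm_circ vw0 weight_perm0 mulgV.
by rewrite -/w /circ wE addNr.
Qed.

End CycleSet.

(** * The brace group: additive Hall subgroups and the action on X *)

(** An alias, so that the pointwise addition of weights and the circle product
live on different types; the circle product is the group law here. *)
Definition brace (X : finType) (r : solution X) : Type := weight r.
HB.instance Definition _ (X : finType) (r : solution X) := Finite.on (brace r).
HB.instance Definition _ (X : finType) (r : solution X) :=
  Finite_isGroup.Build (brace r) (@circA X r) (@circ0 X r) (@circ_invl X r).

Section Brace.
Variables (X : finType) (r : solution X).
Local Notation D := ((diag_perm r)^-1)%g.
Local Notation N := (period_pred r).+1.

Definition brace_act (x : X) (v : brace r) : X := weight_perm v x.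

Lemma brace_act1 : brace_act^~ 1%g =1 id.
Proof. by move=> x; rewrite /brace_act weight_perm0 perm1. Qed.

Lemma brace_actM x : act_morph brace_act x.
Proof. by move=> v w; rewrite /brace_act weight_perm_circ permM. Qed.

Canonical brace_action := TotalAction brace_act1 brace_actM.

Lemma brace_act_unit k x :
  brace_act x (word_weight r (nseq k x)) = (D ^+ k)%g x.
Proof. by rewrite /brace_act -word_permE word_perm_nseq. Qed.

(** Being additively characteristic, it is stable under relabelling, so it is
also a subgroup for the circle product. *)
Definition torsion (n : nat) : {set brace r} :=
  [set v : brace r | ((v : weight r) *+ n == 0)%R].

Lemma relabelMn (g : {perm X}) (w : weight r) n :
  (relabel g (w *+ n) = relabel g w *+ n)%R.
Proof. by apply/ffunP=> x; rewrite !(ffunE, ffunMnE). Qed.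

Fact torsion_group_set n : group_set (torsion n).
Proof.
apply/group_setP; split=> [|v w]; rewrite !inE; first by rewrite mul0rn.
move=> /eqP v0 /eqP w0.
rewrite -[(v * w)%g]/(circ v w) /circ mulrnDl v0 add0r -relabelMn w0.
by apply/eqP/ffunP=> x; rewrite !ffunE.
Qed.
Canonical torsion_group n := Group (torsion_group_set n).

Lemma Zp_torsionE n (i : 'I_N) : n %| N -> (i *+ n == 0)%R = (N %/ n %| i).
Proof.
move=> n_dv; have n_gt0 : 0 < n by exact: dvdn_gt0 n_dv.
rewrite Zp_mulrn -val_eqE /= -[_ == _]/(N %| i * n).
by rewrite -{1}(divnK n_dv) dvdn_pmul2r.
Qed.

Lemma card_torsion n : n %| N -> #|torsion n| = (n ^ #|X|)%N.
Proof.
move=> n_dv; have n_gt0 : 0 < n by exact: dvdn_gt0 n_dv.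
have q_gt0 : 0 < N %/ n by rewrite divn_gt0 // dvdn_leq.
pose A := [pred i : 'I_N | N %/ n %| i].
have -> : #|torsion n| = #|(ffun_on A : pred (weight r))|.
  apply: eq_card => v; rewrite inE; apply/eqP/ffun_onP => [v0 x | v0].
    by rewrite inE -Zp_torsionE // -ffunMnE v0 ffunE.
  apply/ffunP=> x; rewrite ffunMnE ffunE; apply/eqP.
  by rewrite Zp_torsionE //; apply: v0.
rewrite card_ffun_on; congr (_ ^ _)%N.
have lt_jN (j : 'I_n) : (j * (N %/ n) < N)%N.
  by rewrite -{2}(divnK n_dv) mulnC ltn_pmul2l.
(* The n-torsion of Z/N consists of the multiples of N / n. *)
pose f (j : 'I_n) : 'I_N := Ordinal (lt_jN j).
have f_inj : injective f.
  by move=> i j /(congr1 val) /= /eqP; rewrite eqn_pmul2r // => /eqP/val_inj.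
rewrite -[RHS]card_ord -(card_imset _ f_inj); apply: eq_card => i.
rewrite inE; apply/idP/imsetP => [/dvdnP[j def_i] | [j _ ->]];
  last exact: dvdn_mull.
have lt_jn : j < n.
  have := ltn_ord i; rewrite def_i -{2}(divnK n_dv) mulnC ltn_pmul2l //.
by exists (Ordinal lt_jn) => //; apply: val_inj.
Qed.

(** The Hall subgroups of the additive group are subgroups of the brace group of
the same order, for every set of primes; this is what makes the brace group
solvable. *)
Lemma torsion_Hall (pi : nat_pred) :
  (pi.-Hall([set: brace r]) (torsion N`_pi%N))%g.
Proof.
rewrite pHallE subsetT card_torsion ?dvdn_part //= cardsT.
by rewrite card_ffun card_ord partnX.
Qed.

Lemma torsion_unit n k x : N %| k * n -> word_weight r (nseq k x) \in torsion n.
Proof.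
move=> dvN; rewrite inE; apply/eqP/ffunP=> y.
rewrite ffunMnE !ffunE Zp_mulrn; apply: val_inj => /=.
rewrite modnMml count_nseq -mulnA; apply/eqP; exact: dvdn_mull.
Qed.

(** When N = k * n, the n-torsion is the set of additive multiples of k.  It is
generated for the circle product by the multiples k x of the letters alone:
u + k x = u o (k x') for a letter x', so a subgroup that contains all these
multiples is stable under their addition. *)
Lemma torsion_gen n k (K : {group brace r}) :
    N = (k * n)%N ->
    (forall x, word_weight r (nseq k x) \in K) ->
  torsion n \subset K.
Proof.
move=> defN Kk; have n_dv : n %| N by rewrite defN dvdn_mull.
apply/subsetP=> v /[!inE] /eqP v0.
have step x s : word_weight r s \in K -> word_weight r (nseq k x ++ s) \in K.
  move=> Ks; rewrite word_weight_cat addrC.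
  have /(groupM Ks) := Kk (word_perm r s x).
  rewrite -[(_ * _)%g]/(circ _ _) /circ relabel_word -word_permE.
  by rewrite map_nseq permK.
have steps j x s :
    word_weight r s \in K -> word_weight r (nseq (j * k) x ++ s) \in K.
  by elim: j => // j IH Ks; rewrite mulSn nseqD -catA step ?IH.
rewrite -(weight_wordK v) /weight_word.
elim: (enum X) => [|x xs IH] /=.
  rewrite (_ : word_weight r [::] = 1%g) ?group1 //.
  by apply/ffunP=> x; rewrite !ffunE; apply: val_inj.
have /dvdnP[j ->] : k %| v x.
  have n_gt0 : 0 < n by exact: dvdn_gt0 n_dv.
  by rewrite -[k](mulnK _ n_gt0) -defN -Zp_torsionE // -ffunMnE v0 ffunE.
exact: steps.
Qed.

(** An orbit and its complement are stable under all sigma and, as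
tau_y x = lperm (sigma_x y) x, under all tau; so they would decompose r. *)
Lemma indecomposable_transitive x :
  indecomposable r -> orbit brace_action [set: brace r] x = [set: X].
Proof.
move=> indec; set Y := orbit _ _ _; apply/eqP/negPn/negP=> neq_YT; apply: indec.
have Ylperm y z : (lperm r y z \in Y) = (z \in Y).
  have -> : lperm r y z = brace_action z (word_weight r [:: y]).
    by rewrite /= /brace_act -word_permE /= mul1g perm1.
  by rewrite orbit_actr ?inE.
have Ysigma y z : (sigma r y z \in Y) = (z \in Y).
  by rewrite -(Ylperm y) lperm_sigma.
have Ytau y z : (tau r y z \in Y) = (z \in Y) by rewrite tau_lperm Ylperm.
have stable (Z : {set X}) : (forall y z, (sigma r y z \in Z) = (z \in Z)) ->
    (forall y z, (tau r y z \in Z) = (z \in Z)) ->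
    [set r p | p in setX Z Z] = setX Z Z.
  move=> Zsigma Ztau; apply/eqP.
  rewrite eqEcard card_imset ?leqnn ?andbT; last exact: inv_inj (sol_invol r).
  apply/subsetP=> _ /imsetP[[y z] /setXP[Zy Zz] ->].
  rewrite [r (y, z)]surjective_pairing inE /= -/(sigma r y z) -/(tau r z y).
  by rewrite Zsigma Ztau Zz.
exists Y, (~: Y); split; last first.
  by split; apply: stable => y z; rewrite ?inE ?Ysigma ?Ytau.
split; last exact: setUCr.
- by apply/set0Pn; exists x; apply: orbit_refl.
- apply: contraNneq neq_YT => /(congr1 (@setC _)).
  by rewrite setCK setC0 => /eqP.
- by rewrite -setI_eq0 setICr.
Qed.

Lemma expgn_diag_in_orbit (pi : nat_pred) x y :
  y \in orbit brace_action (torsion N`_pi) x ->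
  (D ^+ N`_pi^')%g y \in orbit brace_action (torsion N`_pi) x.
Proof.
move=> Oy; rewrite -brace_act_unit orbit_actr //.
by rewrite torsion_unit // mulnC partnC.
Qed.

(** The index of a Hall pi-subgroup H is prime to n, and #|X| divides the
product of this index with the size of any orbit of H. *)
Lemma dvdn_orbit_torsion (pi : nat_pred) n x :
    indecomposable r -> n %| #|X| -> pi.-nat n ->
  n %| #|orbit brace_action (torsion N`_pi) x|.
Proof.
move=> indec n_dvX pi_n.
set H := torsion_group N`_pi; pose G := [set: brace r]%G.
pose S := ('C_G[x | brace_action])%G.
have [sHG _ pi'GH] := and3P (torsion_Hall pi).
have dvX : #|X| %| #|G : H|%g * #|orbit brace_action H x|.
  rewrite -cardsT -(indecomposable_transitive x indec) !card_orbit.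
  rewrite Lagrange_index ?subsetIl //.
  rewrite -(@Lagrange_index _ G S) ?setSI ?subsetIl //.
  exact: dvdn_mulr.
have := dvdn_trans n_dvX dvX; rewrite Gauss_dvdr //.
exact: pnat_coprime pi_n pi'GH.
Qed.

Lemma brace_solvable : solvable [set: brace r].
Proof.
apply: Hall_solvable => p _; exists (torsion_group N`_p^').
exact: torsion_Hall.
Qed.

(** A generalization of Rump's theorem on square-free solutions, which are those
with T = 1.  If the orders were coprime, let p dividing #|X| be the prime that
the solvability of the brace group gives for a point stabilizer, and P the
Sylow p-subgroup of p-power torsion.  P is generated by the k x with k the
p'-part of N, and the order of the diagonal map divides k, so k x fixes the
point x.  All these generators lie in point stabilizers, which meet P inside
one proper subgroup. *)
Theorem indecomposable_diag_order :
  indecomposable r -> ~~ coprime #[diag_perm r]%g #|X|.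
Proof.
move=> indec; apply/negP=> co_TX.
have /card_gt0P[x0 _] : 0 < #|X| := ltnW (sol_card r).
pose G := [set: brace r]%G; pose S := ('C_G[x0 | brace_action])%G.
have indexS : #|G : S|%g = #|X|.
  by rewrite -card_orbit indecomposable_transitive // cardsT.
have prS : S \proper G.
  by rewrite properE subsetIl -indexg_gt1 indexS sol_card.
have [p /[!indexS]] := solvable_conj_in_proper_Sylow brace_solvable prS.
rewrite mem_primes => /and3P[pr_p _ p_dvX] /(_ _ (torsion_Hall p))[Q prQ sQ].
have Dk1 : (D ^+ N`_p^' = 1)%g.
  apply/eqP; rewrite -order_dvdn orderV.
  have p'T : p^'.-nat #[diag_perm r]%g.
    rewrite p'natE // -prime_coprime // coprime_sym.
    exact: coprime_dvdr p_dvX co_TX.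
  rewrite -(part_pnat_id p'T); apply: partn_dvd => //.
  by rewrite periodE orderV dvdn_mulr.
have /negP[] := proper_subn prQ.
apply: (@torsion_gen _ N`_p^') => [|x].
  by rewrite mulnC partnC.
have /imsetP[v Gv def_x] : x \in orbit brace_action G x0.
  by rewrite indecomposable_transitive ?inE.
apply: (subsetP (sQ v Gv)).
rewrite inE torsion_unit; last by rewrite mulnC partnC.
rewrite conjIg (conjGid Gv) -astab1_act -def_x inE in_setT.
by apply/astab1P; rewrite -[RHS]perm1 -Dk1; apply: brace_act_unit.
Qed.

End Brace.

(** * Cycle lengths of the diagonal map *)

Theorem theorem4 (X : finType) (r : solution X) (a b c c' : nat) :
  0 < a -> 0 < b -> 0 < c -> 0 < c' ->
  coprime a b -> coprime a c -> coprime a c' ->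
  coprime b c -> coprime b c' ->
  indecomposable r ->
  #|X| = a * b ->
  perm_eq (T_partition r) [:: a; c; c'] ->
  ~ (b > a + c).
Proof.
move=> a_gt0 b_gt0 c_gt0 c'_gt0 co_ab co_ac co_ac' co_bc co_bc' indec cardX TP.
move=> ltb.
set T := diag_perm r.
have porbit_size x : #|porbit T x| \in [:: a; c; c'].
  rewrite -(perm_mem TP); apply/map_f; rewrite mem_enum; exact: imset_f.
have [y def_c'] : exists y, #|porbit T y| = c'.
  have : c' \in T_partition r by rewrite (perm_mem TP) !inE eqxx !orbT.
  by case/mapP=> A /[!mem_enum]/imsetP[y _ ->] ->; exists y.
have sum_abc : a + c + c' = a * b.
  rewrite -cardX -cardsT.
  have -> : a + c + c' = sumn (T_partition r).
    by rewrite (perm_sumn TP) /= addn0 addnA.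
  have partT : partition (porbits T) [set: X].
    have -> : porbits T = orbit 'P <[T]>%g @: [set: X].
      apply/setP=> A.
      by apply/imsetP/imsetP=> -[x _ ->]; exists x; rewrite ?porbitE.
    by apply: orbit_partition; apply/actsP=> ? _ ?; rewrite !inE.
  by rewrite (card_partition partT) sumnE big_map big_enum.
(* The Hall subgroup for the primes not dividing a has orbits of size
   divisible by b, and one of them contains the cycle of length c', which is
   longer than (a - 1) * b; so it is transitive, and a divides its order. *)
have def_a : a = 1.
  pose N := (period_pred r).+1; pose pi : nat_pred := \pi(a)^'.
  pose O := orbit (brace_action r) (torsion r N`_pi) y.
  have b_dvO : b %| #|O|.
    apply: dvdn_orbit_torsion => //; first by rewrite cardX dvdn_mull.
    by rewrite -coprime_pi'.
  have c'_leO : c' <= #|O|.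
    rewrite -def_c' -porbitV; apply: subset_leq_card.
    apply: (@porbit_sub_coprime_closed _ _ N`_pi^'); rewrite ?orbit_refl //.
    - rewrite porbitV def_c' coprime_sym.
      by apply: (pnat_coprime (pi := pi)); rewrite ?part_pnat // -coprime_pi'.
    - exact: expgn_diag_in_orbit.
  have O_T : #|O| = a * b.
    have leO : #|O| <= a * b by rewrite -cardX max_card.
    have /dvdnP[q def_O] := b_dvO; rewrite def_O in leO c'_leO *.
    congr (_ * _); apply/eqP; rewrite eqn_leq; rewrite leq_pmul2r // in leO.
    rewrite leO /=.
    have : a.-1 * b < q * b.
      apply: leq_trans c'_leO.
      rewrite -subn1 mulnBl mul1n ltn_subLR ?leq_pmull //.
      by rewrite -sum_abc ltn_add2r.
    by rewrite ltn_pmul2r // prednK.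
  have a_dvH : a %| #|torsion r N`_pi|.
    apply: dvdn_trans (dvdn_orbit (brace_action r) _ y).
    by rewrite -/O O_T dvdn_mulr.
  have piH := pHall_pgroup (torsion_Hall r pi).
  have := pnat_coprime (pnat_pi a_gt0) (pnat_dvd a_dvH piH).
  by rewrite /coprime gcdnn => /eqP.
have /negP[] := indecomposable_diag_order indec.
rewrite cardX def_a mul1n.
have TP1 : #[T]%g %| c * c'.
  rewrite order_dvdn; apply/eqP/permP=> x; rewrite perm1 expgn_porbit //.
  have := porbit_size x; rewrite !inE def_a => /or3P[]/eqP->; rewrite ?dvd1n //.
  - exact: dvdn_mulr.
  - exact: dvdn_mull.
by apply: coprime_dvdl TP1 _; rewrite coprimeMl !(coprime_sym _ b) co_bc.
Qed.
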